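(* Let $(X,\omega)$ be a complex symplectic vector space and let $(\lambda,\mu)$ be an algebraic Fredholm pair of linear subspaces of $X$, i.e. $\dim\lambda\cap\mu<\infty$ and $\dim X/(\lambda+\mu)<\infty$. If $\lambda,\mu$ are isotropic subspaces with $\mathrm{index}(\lambda,\mu)\ge 0$, then $\lambda$ and $\mu$ are Lagrangian subspaces of $X$, and $$\mathrm{index}(\lambda,\mu)=0,\qquad(\lambda+\mu)^\omega=\lambda\cap\mu,\qquad(\lambda+\mu)^{\omega\omega}=\lambda+\mu.$$
   Context: A complex symplectic vector space is a complex vector space $X$ (no topology) with a map $\omega\colon X\times X\to\mathbb C$, linear in the first and conjugate linear in the second variable, with $\omega(y,x)=-\overline{\omega(x,y)}$, and non-degenerate: $\omega(x,y)=0$ for all $y$ implies $x=0$. For a subspace $\lambda$, the annihilator is $\lambda^\omega=\{y\in X:\omega(x,y)=0\ \forall x\in\lambda\}$; $\lambda$ is isotropic if $\lambda\subset\lambda^\omega$ and Lagrangian if $\lambda=\lambda^\omega$. The index of an algebraic Fredholm pair is $\mathrm{index}(\lambda,\mu)=\dim\lambda\cap\mu-\dim X/(\lambda+\mu)$. *)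

(* Defs.v *)
From HB Require Import structures.
From mathcomp Require Import all_boot all_order all_algebra.
From mathcomp Require Import boolp classical_sets.
From mathcomp Require Export reals.
From mathcomp Require Export complex.

Set Implicit Arguments.
Unset Strict Implicit.
Unset Printing Implicit Defensive.

Import GRing.Theory.
Local Open Scope ring_scope.
Local Open Scope quotient_scope.

Section SubspaceSum.
Variables (K : pzRingType) (V : lmodType K).

Definition sum_pred (U W : submodClosed V) : V -> bool :=
  fun x => `[< exists2 u, u \in U & exists2 v, v \in W & x = u + v >].

Lemma sum_pred_closed (U W : submodClosed V) :
  GRing.subsemimod_closed (sum_pred U W).
Proof.
split.
  split.
    apply/asboolP; exists 0; first exact: rpred0.
    by exists 0; rewrite ?rpred0 ?addr0.
  move=> x y /asboolP[u uU [v vW ->]] /asboolP[u' u'U [v' v'W ->]].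
  apply/asboolP; exists (u + u'); first exact: rpredD.
  by exists (v + v'); [exact: rpredD | rewrite addrACA].
move=> a x /asboolP[u uU [v vW ->]].
apply/asboolP; exists (a *: u); first exact: rpredZ.
by exists (a *: v); [exact: rpredZ | rewrite scalerDr].
Qed.

HB.instance Definition _ (U W : submodClosed V) :=
  GRing.isSubmodClosed.Build K V (sum_pred U W) (sum_pred_closed U W).

Definition add_subspace (U W : submodClosed V) : submodClosed V :=
  GRing.SubmodClosed.clone K V (sum_pred U W) _.

End SubspaceSum.

Section QuotientSpace.
Variables (K : pzRingType) (V : lmodType K) (W : submodClosed V).

(* [submodClosed] is stated over semirings, so it does not carry the closure    *)
(* under opposite that [Quotient.quot] requires.                                *)
Definition zmod_pred : V -> bool := fun x => x \in W.

Fact zmod_pred_closed : GRing.zmod_closed zmod_pred.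
Proof.
split=> [|x y xW yW]; first exact: (rpred0 W).
suff: x + -1 *: y \in W by rewrite scaleN1r.
by apply: rpredD => //; apply: rpredZ.
Qed.

HB.instance Definition _ := GRing.isZmodClosed.Build V zmod_pred zmod_pred_closed.

Definition zmod_closed_of : zmodClosed V := GRing.ZmodClosed.clone V zmod_pred _.

(* The library makes [Quotient.quot] an additive group; the scalar              *)
(* multiplication is added here.                                                *)
Definition quot_space : Type := Quotient.quot zmod_closed_of.
HB.instance Definition _ := GRing.Zmodule.on quot_space.
HB.instance Definition _ := EqQuotient.on quot_space.
Local Notation Q := quot_space.

Definition quot_scale (a : K) : Q -> Q := lift_op1 Q ( *:%R a).

Lemma pi_quot_scale a : {morph \pi_Q : x / a *: x >-> quot_scale a x}.
Proof.
move=> x; unlock quot_scale; apply/eqP; rewrite -Quotient.idealrBE -scalerBr.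
suff: x - repr (\pi_Q x) \in zmod_pred by apply: (@rpredZ _ _ W).
by rewrite Quotient.idealrBE reprK.
Qed.

Fact quot_scaleA a b (x : Q) :
  quot_scale a (quot_scale b x) = quot_scale (a * b) x.
Proof. by rewrite -[x]reprK -!pi_quot_scale scalerA. Qed.

Fact quot_scale1 : left_id 1 quot_scale.
Proof. by move=> x; rewrite -[x]reprK -pi_quot_scale scale1r. Qed.

Fact quot_scaleDr : right_distributive quot_scale +%R.
Proof.
move=> a x y; rewrite -[x]reprK -[y]reprK.
by rewrite -raddfD -!pi_quot_scale scalerDr raddfD.
Qed.

Fact quot_scaleDl (x : Q) : {morph quot_scale^~ x : a b / a + b}.
Proof.
by move=> a b /=; rewrite -[x]reprK -!pi_quot_scale scalerDl raddfD.
Qed.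

HB.instance Definition _ := GRing.Zmodule_isLmodule.Build K Q
  quot_scaleA quot_scale1 quot_scaleDr quot_scaleDl.

Definition quot_proj (x : V) : Q := \pi_Q x.

Lemma quot_proj_linear : linear quot_proj.
Proof.
move=> a x y; rewrite /quot_proj.
transitivity (\pi_Q (a *: x) + \pi_Q y); first exact: raddfD.
by rewrite [X in X + _](pi_quot_scale a x).
Qed.

HB.instance Definition _ :=
  GRing.isLinear.Build K V Q *:%R quot_proj quot_proj_linear.

Lemma quot_proj_surj (q : Q) : exists x, quot_proj x = q.
Proof. by exists (repr q); exact: reprK. Qed.

Lemma quot_proj_eq0 x : (quot_proj x == 0) = (x \in W).
Proof.
rewrite -[0](raddf0 quot_proj) -[_ == _]Quotient.idealrBE subr0.
by [].
Qed.

End QuotientSpace.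

Section Dimension.
Variables (K : fieldType) (V : lmodType K).

Definition is_basis (W : {pred V}) n (b : 'I_n -> V) : Prop :=
  [/\ forall i, b i \in W,
      forall c : 'I_n -> K, \sum_i c i *: b i = 0 -> forall i, c i = 0
    & forall x, x \in W -> exists c : 'I_n -> K, x = \sum_i c i *: b i].

Definition finite_dim (W : {pred V}) : Prop :=
  exists n, exists b : 'I_n -> V, is_basis W b.

(* The value is 0 when [W] is not finite-dimensional. *)
Definition dimension (W : {pred V}) : nat :=
  xget 0%N [set n | exists b : 'I_n -> V, is_basis W b]%classic.

Lemma is_basis_leq (W : {pred V}) m n (b : 'I_m -> V) (b' : 'I_n -> V) :
  is_basis W b -> is_basis W b' -> (m <= n)%N.
Proof.
move=> [bW bfree _] [_ _ b'span].
have /choice[c cE] i : exists c : 'I_n -> K, b i = \sum_j c j *: b' j.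
  exact: b'span.
pose A : 'M[K]_(m, n) := \matrix_(i, j) c i j.
suff /eqP <- : row_free A by exact: rank_leq_col.
rewrite -kermx_eq0; apply/eqP/row_matrixP => k; rewrite row0.
have kA : row k (kermx A) *m A = 0 by rewrite -row_mul mulmx_ker row0.
apply/rowP => i; rewrite [RHS]mxE; move: i; apply: bfree.
under eq_bigr => i _ do rewrite cE scaler_sumr.
rewrite exchange_big big1 // => j _.
transitivity ((row k (kermx A) *m A) 0 j *: b' j); last first.
  by rewrite kA mxE scale0r.
rewrite mxE scaler_suml; apply: eq_bigr => i _.
by rewrite [A i j]mxE scalerA.
Qed.

Lemma dimensionE (W : {pred V}) n (b : 'I_n -> V) : is_basis W b -> dimension W = n.
Proof.
move=> bB; apply: xget_unique; first by exists b.
move=> m [b' b'B]; apply/eqP.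
by rewrite eqn_leq (is_basis_leq b'B bB) (is_basis_leq bB b'B).
Qed.

End Dimension.

Section FredholmPair.
Variables (K : fieldType) (X : lmodType K).

Definition fredholm_pair (U W : submodClosed X) : Prop :=
  finite_dim [predI U & W]
  /\ finite_dim (@predT (quot_space (add_subspace U W))).

Definition fredholm_index (U W : submodClosed X) : int :=
  (dimension [predI U & W])%:Z
  - (dimension (@predT (quot_space (add_subspace U W))))%:Z.

End FredholmPair.

(* [{hermitian X for true & conjc}] is the type of forms that are linear in the *)
(* first variable, conjugate linear in the second one, and such that            *)
(* [w x y = - (w y x)^*].                                                       *)
Notation "{ 'skew_hermitian' X }" := ({hermitian X for true & conjc})
  (format "{ 'skew_hermitian'  X }") : ring_scope.

Section ComplexSymplectic.
Variables (R : realType) (X : lmodType R[i]) (w : {skew_hermitian X}).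

Definition nondegenerate_form : Prop :=
  forall x, (forall y, w x y = 0) -> x = 0.

Definition annihilator (U : {pred X}) : {pred X} :=
  [pred y | `[< forall x, x \in U -> w x y = 0 >]].

Definition isotropic (U : submodClosed X) : Prop := {subset U <= annihilator U}.

Definition lagrangian (U : submodClosed X) : Prop := U =i annihilator U.

End ComplexSymplectic.

(* Main.v *)
Require Import Defs.
From mathcomp Require Import all_boot all_order all_algebra.
From mathcomp Require Import boolp.
Local Open Scope ring_scope.

(** Write [S] for the sum of the two isotropic subspaces and [V] for their
intersection. Isotropy places [V] inside the annihilator of [S], and the form
induces a pairing between that annihilator and [X / S] which, by nondegeneracy,
has no kernel on the side of the annihilator. Hence
[dim V <= dim (annihilator of S) <= dim X / S], while a nonnegative index says
[dim X / S <= dim V]: all three dimensions agree, the annihilator of [S] is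
[V], and the pairing of [V] with [X / S], now between spaces of equal finite
dimension, has no kernel on the side of [X / S] either, which means that the
double annihilator of [S] is [S]. The whole
duality is carried by the finite matrix of the form between a basis of [V] and
representatives of a basis of [X / S] ([pairing_mx_row_free],
[pairing_mx_row_full]).

That both subspaces are Lagrangian is a consequence of these two equalities
([sub_annihilator_addl]): a vector orthogonal to one of them is orthogonal to
[V], so it lies in the double annihilator of [S], that is in [S], and its
component in the other subspace lies in the annihilator of [S], that is in
[V]. *)

Set Implicit Arguments.
Unset Strict Implicit.
Unset Printing Implicit Defensive.

Import GRing.Theory Num.Theory.

(** The vectors [e i] stand in for a complement of [W]: together with [W] they
reach all of [V], so the form can be tested on them without working in the
quotient. *)
Lemma quot_representatives (K : fieldType) (V : lmodType K)
    (W : submodClosed V) n (b : 'I_n -> quot_space W) :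
  is_basis predT b ->
  exists e : 'I_n -> V,
    forall x, exists c : 'I_n -> K, x - \sum_i c i *: e i \in W.
Proof.
case=> _ _ b_span; have [e eb] := choice (fun i => quot_proj_surj (b i)).
exists e => x; have [c xE] := b_span (quot_proj W x) isT.
exists c; rewrite -quot_proj_eq0 linearB linear_sum /= xE subr_eq0.
by apply/eqP/eq_bigr => i _; rewrite linearZ /= eb.
Qed.

Section Annihilator.
Variables (R : realType) (X : lmodType R[i]) (w : {skew_hermitian X}).

Lemma skew_form_eq0C x y : w x y = 0 -> w y x = 0.
Proof. by move=> wxy; rewrite hermC /= wxy rmorph0 mulr0. Qed.

Lemma annihilatorP (U : {pred X}) y :
  reflect (forall x, x \in U -> w x y = 0) (y \in annihilator w U).
Proof. exact: asboolP. Qed.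

Lemma annihilator_leftP (U : {pred X}) y :
  reflect (forall x, x \in U -> w y x = 0) (y \in annihilator w U).
Proof.
by apply: (iffP (annihilatorP U y)) => yU x /yU/skew_form_eq0C.
Qed.

Lemma mem_add_subspace (U W : submodClosed X) x :
  reflect (exists2 u, u \in U & exists2 v, v \in W & x = u + v)
    (x \in add_subspace U W).
Proof. exact: asboolP. Qed.

Lemma annihilator_add (U W : submodClosed X) y :
  (y \in annihilator w (add_subspace U W))
    = (y \in annihilator w U) && (y \in annihilator w W).
Proof.
apply/annihilatorP/andP => [yUW | [/annihilatorP yU /annihilatorP yW] x].
  split; apply/annihilatorP => x xU; apply/yUW/mem_add_subspace.
    by exists x => //; exists 0; [exact: rpred0 | rewrite addr0].
  by exists 0; [exact: rpred0 | exists x => //; rewrite add0r].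
case/mem_add_subspace=> u uU [v vW ->].
by rewrite linearDl /= yU // yW // addr0.
Qed.

Lemma sub_annihilator2 (U : {pred X}) :
  {subset U <= annihilator w (annihilator w U)}.
Proof.
by move=> x xU; apply/annihilatorP => y /annihilator_leftP; apply.
Qed.

Lemma annihilator_sub (U W : {pred X}) :
  {subset U <= W} -> {subset annihilator w W <= annihilator w U}.
Proof.
by move=> UW y /annihilatorP yW; apply/annihilatorP => x /UW/yW.
Qed.

(** A vector orthogonal to [U] is orthogonal to [[predI U & W]], hence to the
annihilator of [add_subspace U W], hence is some [u + v] with [u] in [U] and [v]
in [W]. Isotropy makes [v] orthogonal to both [U] and [W], which forces it back
into [U]. *)
Lemma sub_annihilator_addl (U W : submodClosed X) :
  isotropic w U -> isotropic w W ->
  {subset annihilator w (add_subspace U W) <= [predI U & W]} ->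
  {subset annihilator w (annihilator w (add_subspace U W))
     <= add_subspace U W} ->
  lagrangian w U.
Proof.
move=> isoU isoW annS biannS y; apply/idP/idP => [/isoU // | yU].
have/biannS/mem_add_subspace[u uU [v vW yE]] :
    y \in annihilator w (annihilator w (add_subspace U W)).
  by apply: (annihilator_sub _ yU) => x /annS/andP[].
suff /annS/andP[vU _] : v \in annihilator w (add_subspace U W).
  by rewrite yE; apply: rpredD.
rewrite annihilator_add isoW // andbT.
have -> : v = y - u by rewrite yE addrC addKr.
apply/annihilatorP => x xU.
move/annihilatorP: yU => /(_ x xU) yx; move/isoU/annihilatorP: uU => uU.
by rewrite linearBr /= yx uU // subr0.
Qed.

Section Pairing.
Hypothesis w_nondeg : nondegenerate_form w.

Variables (S : {pred X}) (d k : nat) (e : 'I_d -> X) (b : 'I_k -> X).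
Hypothesis e_span :
  forall x, exists c : 'I_d -> R[i], x - \sum_i c i *: e i \in S.
Hypothesis b_free :
  forall c : 'I_k -> R[i], \sum_j c j *: b j = 0 -> forall j, c j = 0.
Hypothesis b_ann : forall j, b j \in annihilator w S.

Lemma annihilator_eq0 y :
  y \in annihilator w S -> (forall i, w y (e i) = 0) -> y = 0.
Proof.
move=> /annihilator_leftP yS ye; apply: w_nondeg => x.
have [c /yS] := e_span x.
rewrite linearBr /= linear_sumr big1 ?subr0 // => i _.
by rewrite linearZr_LR /= ye mulr0.
Qed.

Definition pairing_mx : 'M[R[i]]_(k, d) := \matrix_(j, i) w (b j) (e i).

Lemma form_comb_left (c : 'rV[R[i]]_k) i :
  w (\sum_j c 0 j *: b j) (e i) = (c *m pairing_mx) 0 i.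
Proof.
rewrite linear_sumlz mxE; apply: eq_bigr => j _.
by rewrite linearZl_LR !mxE.
Qed.

Lemma comb_annihilator (c : 'rV[R[i]]_k) :
  \sum_j c 0 j *: b j \in annihilator w S.
Proof.
apply/annihilator_leftP => x xS; rewrite linear_sumlz big1 // => j _.
by have /annihilator_leftP bS := b_ann j; rewrite linearZl_LR /= bS // mulr0.
Qed.

(** A linear relation between the rows is a combination of [b] orthogonal to
every [e i] and to [S], hence to the whole space. *)
Lemma pairing_mx_row_free : row_free pairing_mx.
Proof.
rewrite -kermx_eq0; apply/eqP/row_matrixP => l; rewrite row0.
set c := row l _.
have cB : c *m pairing_mx = 0 by rewrite -row_mul mulmx_ker row0.
apply/rowP => j; rewrite [RHS]mxE; move: j; apply: b_free.
apply: annihilator_eq0 => [|i]; first exact: comb_annihilator.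
by rewrite form_comb_left cB mxE.
Qed.

Lemma free_size_le_codim : (k <= d)%N.
Proof. by rewrite -(eqP pairing_mx_row_free) rank_leq_col. Qed.

Hypothesis le_dk : (d <= k)%N.

Lemma pairing_mx_row_full : row_full pairing_mx.
Proof. by rewrite -col_leq_rank (eqP pairing_mx_row_free). Qed.

(** Since the rows of the pairing span everything, some combination of [b] has
the same products with the [e i] as a given [y] orthogonal to [S]. *)
Lemma annihilator_spanned y :
  y \in annihilator w S -> exists c : 'rV[R[i]]_k, y = \sum_j c 0 j *: b j.
Proof.
move=> /annihilator_leftP yS.
have /submxP[c yc] := submx_full (\row_i w y (e i)) pairing_mx_row_full.
exists c; apply/subr0_eq/annihilator_eq0 => [|i].
  have /annihilator_leftP cS := comb_annihilator c.
  by apply/annihilator_leftP => x xS; rewrite linearBl /= yS // cS // subr0.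
by rewrite linearBl /= form_comb_left -yc mxE subrr.
Qed.

(** Modulo [S], an element of the double annihilator is a combination of the
[e i]; its products with the [b j] vanish, and the pairing matrix has a left
inverse, so its coefficients are zero. *)
Lemma annihilator2_sub : {subset annihilator w (annihilator w S) <= S}.
Proof.
move=> x /annihilatorP xSS; have [c xS] := e_span x.
suff c0 i : c i = 0.
  by move: xS; rewrite big1 ?subr0 // => i _; rewrite c0 scale0r.
pose v : 'cV[R[i]]_d := \col_i conjc (c i).
have Bv : pairing_mx *m v = 0.
  apply/colP => j; rewrite !mxE.
  have /annihilator_leftP/(_ _ xS) := b_ann j.
  rewrite linearBr /= xSS // sub0r linear_sumr => /eqP; rewrite oppr_eq0 => /eqP s0.
  rewrite -[RHS]s0; apply: eq_bigr => l _.
  by rewrite linearZr_LR !mxE mulrC.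
have /row_fullP[B' B'B] := pairing_mx_row_full.
have: v = 0 by rewrite -[v]mul1mx -B'B -mulmxA Bv mulmx0.
move/colP/(_ i); rewrite !mxE => /(congr1 conjc).
by rewrite conjcK conjc0.
Qed.

End Pairing.
End Annihilator.

Theorem proposition1 (R : realType) (X : lmodType R[i])
    (omega : {skew_hermitian X}) (lambda mu : submodClosed X) :
  nondegenerate_form omega ->
  fredholm_pair lambda mu ->
  isotropic omega lambda ->
  isotropic omega mu ->
  0 <= fredholm_index lambda mu ->
  [/\ lagrangian omega lambda,
      lagrangian omega mu,
      fredholm_index lambda mu = 0,
      annihilator omega (add_subspace lambda mu) =i [predI lambda & mu]
    & annihilator omega (annihilator omega (add_subspace lambda mu))
        =i add_subspace lambda mu].
Proof.
move=> nondeg [[k [b b_basis]] [d [q q_basis]]] isoL isoM.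
rewrite /fredholm_index (dimensionE b_basis) (dimensionE q_basis).
rewrite subr_ge0 lez_nat => le_dk.
have [e e_span] := quot_representatives q_basis.
have [bV b_free _] := b_basis.
have V_sub :
    {subset [predI lambda & mu] <= annihilator omega (add_subspace lambda mu)}.
  by move=> x /andP[xL xM]; rewrite annihilator_add isoL // isoM.
have b_ann j := V_sub _ (bV j).
have annS : {subset annihilator omega (add_subspace lambda mu)
                 <= [predI lambda & mu]}.
  move=> y /(annihilator_spanned nondeg e_span b_free b_ann le_dk)[c ->].
  by apply/andP; split; apply: rpred_sum => j _; apply: rpredZ;
     case/andP: (bV j).
have biannS := annihilator2_sub nondeg e_span b_free b_ann le_dk.
have le_kd := free_size_le_codim nondeg e_span b_free b_ann.
have addC : add_subspace mu lambda =i add_subspace lambda mu.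
  move=> x; apply/mem_add_subspace/mem_add_subspace.
    by case=> u uM [v vL ->]; exists v => //; exists u => //; rewrite addrC.
  by case=> u uM [v vL ->]; exists v => //; exists u => //; rewrite addrC.
split.
- exact: (sub_annihilator_addl isoL isoM).
- apply: (sub_annihilator_addl isoM isoL) => x.
    rewrite annihilator_add andbC -annihilator_add => /annS /andP[xL xM].
    exact/andP.
  rewrite addC => xS; apply: biannS; apply: annihilator_sub xS => y.
  by rewrite !annihilator_add andbC.
- by apply/eqP; rewrite subr_eq0 eqz_nat eqn_leq le_kd le_dk.
- by move=> y; apply/idP/idP => [/annS | /V_sub].
- by move=> x; apply/idP/idP => [/biannS | /sub_annihilator2].
Qed.
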